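(* Let $k\geq 2$ and $s\geq 3$ be integers. Let $G$ arise from the disjoint union of $s$ cliques $C_0,\ldots,C_{s-1}$, each with $k+2$ vertices, by adding, for every $i\in\{0,\ldots,s-1\}$, the edges of a matching $M_i$ of size $k+2$ between $C_i$ and $C_{i+1}$ (indices modulo $s$), and by adding one further vertex $u$ together with all $k+2$ possible edges between $u$ and $C_0$. Then $G$ has order $n=(k+2)s+1$ and size $m=\left(\frac{k+3}{2}n+\frac{k-1}{2}\right)+1$, and the only minimum cut of $G$ is $N_G(u)=C_0$, which is not $k$-degenerate.
   Context: All graphs are finite, simple, and undirected. The order of a graph is its number of vertices and its size is its number of edges. $N_G(u)$ denotes the set of neighbors of $u$ in $G$. For a non-negative integer $k$, a graph $H$ is $k$-degenerate if every non-empty subgraph $H'$ of $H$ has a vertex $v$ of degree $d_{H'}(v)$ at most $k$. A set $S$ of vertices of a graph $G$ is a cut of $G$ if $G-S$ is disconnected (has at least two connected components). A minimum cut of $G$ is a cut of minimum cardinality among all cuts of $G$. A cut $S$ is $k$-degenerate if the induced subgraph $G[S]$ is $k$-degenerate. *)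

(* Defs.v *)
From mathcomp Require Import all_boot.

Set Implicit Arguments.
Unset Strict Implicit.
Unset Printing Implicit Defensive.

(* A finite simple undirected graph has its vertices in an ambient finite type
   T, so that a graph and its subgraphs share one type; the edges are
   two-element sets of vertices. *)
Record graph (T : finType) := Graph {
  verts : {set T};
  edges : {set {set T}};
  edgesP : forall e, e \in edges -> (e \subset verts) && (#|e| == 2)
}.

Section Graphs.
Variable T : finType.
Implicit Types (G H : graph T) (S A B : {set T}).

Definition graph_order G : nat := #|verts G|.

Definition graph_size G : nat := #|edges G|.

(* Irreflexive, since [set x; x] has only one element. *)
Definition adj G : rel T := fun x y => [set x; y] \in edges G.

Definition neighbors G (x : T) : {set T} := [set y | adj G x y].

Definition degree G (x : T) : nat := #|neighbors G x|.

Definition subgraph H G : Prop :=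
  (verts H \subset verts G) /\ (edges H \subset edges G).

Lemma induced_edgesP G S e :
  e \in [set e in edges G | e \subset S] ->
  (e \subset verts G :&: S) && (#|e| == 2).
Proof.
by rewrite inE subsetI => /andP[/edgesP/andP[-> ->] ->].
Qed.

Definition induced G S : graph T := Graph (@induced_edgesP G S).

Definition remove G S : graph T := induced G (verts G :\: S).

Definition degenerate (k : nat) H : Prop :=
  forall H', subgraph H' H -> verts H' != set0 ->
    exists2 v, v \in verts H' & degree H' v <= k.

(* [n_comp (adj H) (verts H)] counts the connected components of H: [verts H]
   is closed under the symmetric relation [adj H], so elements of T that are
   not vertices of H do not contribute. *)
Definition disconnected H : bool := 2 <= n_comp (adj H) (verts H).

Definition is_cut G S : Prop := S \subset verts G /\ disconnected (remove G S).

Definition minimum_cut G S : Prop :=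
  is_cut G S /\ forall S', is_cut G S' -> #|S| <= #|S'|.

(* Meant for S a cut of G. *)
Definition degenerate_cut (k : nat) G S : Prop := degenerate k (induced G S).

Definition clique_edges A : {set {set T}} :=
  [set e : {set T} | (e \subset A) && (#|e| == 2)].

Definition matching_between A B (M : {set {set T}}) : Prop :=
  trivIset M /\
  forall e, e \in M -> exists x y, [/\ x \in A, y \in B & e = [set x; y]].

(* Only the values of C and M at indices i < s are relevant. *)
Record clique_cycle_with_apex (k s : nat) G (C : nat -> {set T})
    (M : nat -> {set {set T}}) (u : T) : Prop := CliqueCycleWithApex {
  cc_card : forall i, i < s -> #|C i| = k + 2;
  cc_disjoint : forall i j, i < s -> j < s -> i != j -> [disjoint C i & C j];
  cc_matching : forall i, i < s -> matching_between (C i) (C (i.+1 %% s)) (M i);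
  cc_matching_card : forall i, i < s -> #|M i| = k + 2;
  cc_apex : forall i, i < s -> u \notin C i;
  cc_verts : verts G = u |: \bigcup_(i < s) C i;
  cc_edges : edges G =
    \bigcup_(i < s) clique_edges (C i) :|: \bigcup_(i < s) M i
      :|: [set [set u; x] | x in C 0]
}.

End Graphs.

(* Main.v *)
Require Import Defs.
From mathcomp Require Import all_boot all_order all_algebra.
From mathcomp Require Import zify ring.

Set Implicit Arguments.
Unset Strict Implicit.
Unset Printing Implicit Defensive.

(* Let S be a set of at most k + 2 vertices other than C_0. Hitting every edge of
   M_i takes k + 2 vertices, so if S does so then |S| = k + 2 and S is contained
   in C_i :|: C_(i+1). As s >= 3, two such indices force S to be the clique
   common to both pairs. Hence each vertex outside S can still walk round the
   cycle to C_0 in one of the two directions, so that S is not a cut. *)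

(** * Adjacency, connectedness, hitting sets and degeneracy in arbitrary graphs *)

Section GraphLemmas.
Variable T : finType.
Implicit Types (G H : graph T) (S A : {set T}) (M : {set {set T}}).

Lemma adj_sym G : symmetric (adj G).
Proof. by move=> x y; rewrite /adj setUC. Qed.

Lemma connect_adj_sym G : connect_sym (adj G).
Proof. exact/sym_connect_sym/adj_sym. Qed.

Lemma adj_verts G x y : adj G x y -> (x \in verts G) && (y \in verts G).
Proof. by case/edgesP/andP; rewrite subUset !sub1set. Qed.

Lemma closed_verts G : closed (adj G) (verts G).
Proof. by move=> x y /adj_verts/andP[-> ->]. Qed.

Lemma adj_induced G S x y :
  adj (induced G S) x y = [&& adj G x y, x \in S & y \in S].
Proof. by rewrite /adj inE subUset !sub1set. Qed.

Lemma verts_remove G S : verts (remove G S) = verts G :\: S.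
Proof. by apply/setP=> x; rewrite !inE; case: (x \in verts G); rewrite ?andbF. Qed.

Lemma adj_remove G S x y :
  adj (remove G S) x y = [&& adj G x y, x \notin S & y \notin S].
Proof.
rewrite adj_induced !inE; apply: andb_id2l => /adj_verts/andP[-> ->].
by rewrite !andbT.
Qed.

(** Components are counted by their roots. The root of a vertex of [H] is again a vertex because
    [verts H] is closed under adjacency, so two unconnected vertices yield two distinct roots. *)
Lemma disconnectedP H :
  reflect (exists x y, [/\ x \in verts H, y \in verts H & ~~ connect (adj H) x y])
          (disconnected H).
Proof.
have symH := connect_adj_sym H.
have rootV x : x \in verts H -> fingraph.root (adj H) x \in verts H.
  by rewrite (closed_connect (@closed_verts H) (connect_root _ _)).
apply: (iffP card_gt1P) => [[x [y [xP yP neq]]]|[x [y [xH yH nxy]]]].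
  move: xP yP; rewrite !inE => /andP[/eqP rx xH] /andP[/eqP ry yH].
  exists x, y; split=> //; apply: contraNN neq => /(fingraph.rootP symH).
  by rewrite rx ry => ->.
exists (fingraph.root (adj H) x), (fingraph.root (adj H) y).
split; rewrite ?inE ?roots_root ?rootV //.
by apply: contraNN nxy => /eqP/(fingraph.rootP symH).
Qed.

(** Sending each point of [A] to its block in [M] reaches every block, since each block meets [A]
    and the blocks are disjoint. *)
Lemma leq_card_hitting_set M A :
  trivIset M -> (forall e, e \in M -> ~~ [disjoint e & A]) -> #|M| <= #|A|.
Proof.
move=> trM hit; apply: leq_trans (leq_imset_card (pblock M) A).
apply/subset_leq_card/subsetP=> e eM.
have /pred0Pn[x /andP[/= xe xA]] := hit e eM.
by apply/imsetP; exists x; rewrite ?(def_pblock trM eM xe).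
Qed.

Lemma card_clique_edges A : #|clique_edges A| = 'C(#|A|, 2).
Proof. exact: cards_draws. Qed.

Lemma set2_in_clique_edges A x y :
  x \in A -> y \in A -> x != y -> [set x; y] \in clique_edges A.
Proof. by move=> xA yA xy; rewrite inE subUset !sub1set xA yA cards2 xy. Qed.

Lemma card_bigcup_disjoint (U : finType) n (F : 'I_n -> {set U}) c :
    (forall i j, i != j -> [disjoint F i & F j]) ->
    (forall i, #|F i| = c) ->
  #|\bigcup_i F i| = n * c.
Proof.
move=> dF cF; rewrite -sum1_card partition_disjoint_bigcup //.
under eq_bigr => i _ do rewrite sum1_card cF.
by rewrite sum_nat_const card_ord.
Qed.

(** The induced graph is its own witness: each vertex of [A] is adjacent to all the others, of which
    there are more than [k]. *)
Lemma clique_not_degenerate G A k :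
    A \subset verts G -> clique_edges A \subset edges G -> k.+1 < #|A| ->
  ~ degenerate k (induced G A).
Proof.
move=> /setIidPr AV AE kA /(_ (induced G A)) [].
- by split.
- by rewrite /= AV -card_gt0; apply: leq_trans kA.
move=> v; rewrite /= AV => vA; rewrite leqNgt => /negP[].
apply: (@leq_trans #|A :\ v|); first by move: kA; rewrite (cardsD1 v) vA.
apply/subset_leq_card/subsetP=> x; rewrite !inE => /andP[xv xA].
rewrite adj_induced vA xA !andbT; apply: (subsetP AE).
by rewrite set2_in_clique_edges // eq_sym.
Qed.

End GraphLemmas.

(** * Incidences between the cliques, the matchings and the apex *)

Section CliqueCycle.
Variables (T : finType) (k s : nat) (G : graph T).
Variables (C : nat -> {set T}) (M : nat -> {set {set T}}) (u : T).
Hypotheses (hs : 2 < s) (hG : clique_cycle_with_apex k s G C M u).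

Let s_gt0 : 0 < s. Proof. exact: leq_trans hs. Qed.

Lemma succ_mod i : i < s -> i.+1 %% s = if i.+1 == s then 0 else i.+1.
Proof.
move=> lti; case: eqP => [->|ne]; first by rewrite modnn.
by rewrite modn_small //; lia.
Qed.

Lemma succ_mod_lt i : i.+1 %% s < s.
Proof. exact: ltn_pmod. Qed.

Lemma clique_index_inj i j x :
  i < s -> j < s -> x \in C i -> x \in C j -> i = j.
Proof.
move=> ltis ltjs xi xj; apply/eqP; apply: contraLR xj => ne.
by rewrite (disjointFr (cc_disjoint hG ltis ltjs ne)).
Qed.

Lemma clique_sub_verts i : i < s -> C i \subset verts G.
Proof.
move=> ltis; rewrite (cc_verts hG); apply: subsetU; apply/orP; right.
exact: (bigcup_sup (Ordinal ltis)).
Qed.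

Lemma apex_in_verts : u \in verts G.
Proof. by rewrite (cc_verts hG) setU11. Qed.

Lemma vertsE x : x \in verts G -> x = u \/ exists2 i, i < s & x \in C i.
Proof.
rewrite (cc_verts hG) => /setU1P[|/bigcupP[i _ xi]]; first by left.
by right; exists i.
Qed.

Lemma clique_edges_sub_edges i : i < s -> clique_edges (C i) \subset edges G.
Proof.
move=> ltis; rewrite (cc_edges hG) -setUA; apply: subsetU; apply/orP; left.
exact: (bigcup_sup (Ordinal ltis)).
Qed.

Lemma matching_sub_edges i : i < s -> M i \subset edges G.
Proof.
move=> ltis; rewrite (cc_edges hG) -setUA; apply: subsetU; apply/orP; right.
apply: subsetU; apply/orP; left; exact: (bigcup_sup (Ordinal ltis)).
Qed.

Lemma adj_clique i x y :
  i < s -> x \in C i -> y \in C i -> x != y -> adj G x y.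
Proof.
move=> ltis xi yi xy; apply: (subsetP (clique_edges_sub_edges ltis)).
exact: set2_in_clique_edges.
Qed.

Lemma matchingE i e : i < s -> e \in M i ->
  exists x y, [/\ x \in C i, y \in C (i.+1 %% s) & e = [set x; y]].
Proof. by move=> ltis; apply: (cc_matching hG ltis).2. Qed.

Lemma matching_apexF i e : i < s -> e \in M i -> u \notin e.
Proof.
move=> ltis /(matchingE ltis)[x [y [xi yi ->]]].
rewrite !inE negb_or; apply/andP; split.
  by apply: contraNneq (cc_apex hG ltis) => ->.
by apply: contraNneq (cc_apex hG (succ_mod_lt i)) => ->.
Qed.

Lemma clique_edge_apexF i e : i < s -> e \in clique_edges (C i) -> u \notin e.
Proof.
move=> ltis; rewrite inE => /andP[/subsetP sub _].
by apply: contra (cc_apex hG ltis) => /sub.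
Qed.

Lemma neighbors_apex : neighbors G u = C 0.
Proof.
apply/setP=> y; rewrite inE /adj (cc_edges hG) !in_setU.
apply/idP/idP => [|yC]; last first.
  by apply/orP; right; apply/imsetP; exists y.
case/orP=> [/orP[]/bigcupP[i _]|/imsetP[x xC eq]].
- by move/(clique_edge_apexF (ltn_ord i)); rewrite set21.
- by move/(matching_apexF (ltn_ord i)); rewrite set21.
have: x \in [set u; y] by rewrite eq set22.
case/set2P=> [xu|<- //]; case/negP: (cc_apex hG s_gt0).
by rewrite -xu.
Qed.

(** * Counting vertices and edges *)

Lemma clique_cycle_order : graph_order G = (k + 2) * s + 1.
Proof.
rewrite /graph_order (cc_verts hG) cardsU1 addnC mulnC.
have -> : u \notin \bigcup_(i < s) C i.
  by apply/bigcupP=> -[i _]; apply/negP/(cc_apex hG (ltn_ord i)).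
congr (_ + _); apply: (card_bigcup_disjoint (F := fun i : 'I_s => C i)).
  by move=> i j ne; apply: (cc_disjoint hG).
by move=> i; apply: (cc_card hG).
Qed.

Lemma clique_edges_disjoint i j : i < s -> j < s -> i != j ->
  [disjoint clique_edges (C i) & clique_edges (C j)].
Proof.
move=> ltis ltjs ne; apply/pred0P=> e /=; apply/negP=> /andP[].
rewrite !inE => /andP[/subsetP ei e2] /andP[/subsetP ej _].
have /card_gt0P[x xe] : 0 < #|e| by rewrite (eqP e2).
by case/eqP: ne; apply: (clique_index_inj ltis ltjs (ei x xe) (ej x xe)).
Qed.

(** A common edge has an end in [C i], which forces [i = j + 1] modulo [s]; its other end then gives
    [j + 2 = j] or [j + 2 = j + 1] modulo [s], impossible for [s >= 3]. *)
Lemma matchings_disjoint i j : i < s -> j < s -> i != j ->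
  [disjoint M i & M j].
Proof.
move=> ltis ltjs ne; apply/pred0P=> e /=; apply/negP=> /andP[].
move=> /(matchingE ltis)[x [y [xi yi ->]]] /(matchingE ltjs)[z [t [zj tj eq]]].
have ltis' := succ_mod_lt i; have ltjs' := succ_mod_lt j.
have xzt : x \in [set z; t] by rewrite -eq set21.
have yzt : y \in [set z; t] by rewrite -eq set22.
have xj : x \in C (j.+1 %% s).
  case/set2P: xzt => <-// in zj tj *.
  by case/eqP: ne; apply: (clique_index_inj _ _ xi zj).
have yj : y \in C j \/ y \in C (j.+1 %% s).
  by case/set2P: yzt => ->; [left|right].
have := clique_index_inj ltis ltjs' xi xj.
case: yj => [/(clique_index_inj ltis' ltjs yi)|/(clique_index_inj ltis' ltjs' yi)];
  rewrite !succ_mod //; do 2?case: eqP; lia.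
Qed.

Lemma clique_edges_matching_disjoint i j : i < s -> j < s ->
  [disjoint clique_edges (C i) & M j].
Proof.
move=> ltis ltjs; apply/pred0P=> e /=; apply/negP=> /andP[].
rewrite inE => /andP[/subsetP sub _] /(matchingE ltjs)[x [y [xj yj eq]]].
have xi : x \in C i by apply: sub; rewrite eq set21.
have yi : y \in C i by apply: sub; rewrite eq set22.
have := clique_index_inj ltis ltjs xi xj.
have := clique_index_inj ltis (succ_mod_lt j) yi yj.
rewrite succ_mod //; case: eqP; lia.
Qed.

Lemma card_apex_edges : #|[set [set u; x] | x in C 0]| = k + 2.
Proof.
rewrite card_in_imset ?(cc_card hG) // => x y xC yC eq.
have: x \in [set u; y] by rewrite -eq set22.
by case/set2P=> // xu; case/negP: (cc_apex hG s_gt0); rewrite -xu.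
Qed.

Lemma clique_cycle_size :
  graph_size G = s * 'C(k + 2, 2) + s * (k + 2) + (k + 2).
Proof.
rewrite /graph_size (cc_edges hG) cardsU disjoint_setI0 ?cards0 ?subn0; last first.
  apply/pred0P=> e /=; apply/negP=> /andP[+ /imsetP[x _ eq]].
  rewrite inE => /orP[]/bigcupP[i _].
    by move/(clique_edge_apexF (ltn_ord i)); rewrite eq set21.
  by move/(matching_apexF (ltn_ord i)); rewrite eq set21.
rewrite card_apex_edges; congr (_ + _).
rewrite cardsU disjoint_setI0 ?cards0 ?subn0; last first.
  apply/pred0P=> e /=; apply/negP=> /andP[/bigcupP[i _ ei] /bigcupP[j _ ej]].
  by rewrite (disjointFr (clique_edges_matching_disjoint _ _) ei) in ej.
congr (_ + _).
  apply: (card_bigcup_disjoint (F := fun i : 'I_s => clique_edges (C i))).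
    by move=> i j ne; apply: clique_edges_disjoint.
  by move=> i; rewrite card_clique_edges (cc_card hG).
apply: (card_bigcup_disjoint (F := fun i : 'I_s => M i)).
  by move=> i j ne; apply: matchings_disjoint.
by move=> i; apply: (cc_matching_card hG).
Qed.

(** * The clique [C 0] is a cut *)

Lemma apex_clique_cut : is_cut G (C 0).
Proof.
split; first exact: clique_sub_verts.
have lt1s : 1 < s by apply: ltnW.
have /card_gt0P[x x1] : 0 < #|C 1| by rewrite (cc_card hG) // addn2.
have xN0 : x \notin C 0 by apply/negP=> /(clique_index_inj lt1s s_gt0 x1).
apply/disconnectedP; exists u, x; rewrite !verts_remove !inE xN0 apex_in_verts.
rewrite (cc_apex hG) // (subsetP (clique_sub_verts lt1s)) //; split=> //.
(* A path from [u] to [x] is either empty, which would put [u] in [C 1], or starts with a step to a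
   neighbor of [u], and all of these were deleted. *)
apply/negP=> /connectP[[/= _ eq|y p /= /andP[+ _] _]].
  by case/negP: (cc_apex hG lt1s); rewrite -eq.
rewrite adj_remove => /and3P[uy _]; rewrite -neighbors_apex inE.
by rewrite uy.
Qed.

(** * Sets of at most [k + 2] vertices other than [C 0] are not cuts *)

Section SmallCut.
Variable S : {set T}.
Hypotheses (leS : #|S| <= k + 2) (neS : S != C 0).

Local Notation linked := (connect (adj (remove G S))).

Let linked_clique i x y : i < s -> x \in C i -> y \in C i ->
  x \notin S -> y \notin S -> linked x y.
Proof.
move=> ltis xi yi xS yS; have [->|ne] := eqVneq x y; first exact: connect0.
by apply: connect1; rewrite adj_remove xS yS (adj_clique ltis).
Qed.

(** When this fails, some edge of [M i] survives the deletion of [S] and a walk can pass between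
    [C i] and the next clique. *)
Definition blocked i := [forall e in M i, ~~ [disjoint e & S]].

(* The k + 2 pairwise disjoint edges of [M i] need k + 2 vertices to be hit. *)
Lemma blocked_sub i : i < s -> blocked i ->
  S \subset C i :|: C (i.+1 %% s) /\ #|S| = k + 2.
Proof.
move=> ltis /forall_inP hit.
(* The edges of [M i] lie within the two cliques, so already this part of [S] hits them all; as [S]
   has at most [k + 2] elements, it is all of [S]. *)
have : k + 2 <= #|S :&: (C i :|: C (i.+1 %% s))|.
  rewrite -(cc_matching_card hG ltis); apply: leq_card_hitting_set.
    by have [] := cc_matching hG ltis.
  move=> e eM; have /pred0Pn[x /andP[/= xe xS]] := hit e eM.
  apply/pred0Pn; exists x; rewrite /= xe !inE xS /=.
  have [y [z [yi zi eq]]] := matchingE ltis eM.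
  by move: xe; rewrite eq => /set2P[]->; rewrite ?yi ?zi ?orbT.
move=> le; have le' := leq_trans leS le.
have sub : S \subset C i :|: C (i.+1 %% s).
  by apply/setIidPl/eqP; rewrite eqEcard subsetIl.
by split=> //; apply/eqP; rewrite eqn_leq leS (leq_trans le) // subset_leq_card ?subsetIl.
Qed.

Let unblocked_link i : i < s -> ~~ blocked i -> exists x y,
  [/\ x \in C i, y \in C (i.+1 %% s), x \notin S, y \notin S & linked x y].
Proof.
move=> ltis; rewrite negb_forall_in => /exists_inP[e eM /negPn dis].
have [x [y [xi yi eq]]] := matchingE ltis eM.
have xS : x \notin S by rewrite (disjointFr dis) // eq set21.
have yS : y \notin S by rewrite (disjointFr dis) // eq set22.
exists x, y; split=> //; apply: connect1; rewrite adj_remove xS yS /adj -eq.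
by rewrite (subsetP (matching_sub_edges ltis)).
Qed.

(** Induction on [j]: cross the clique [C j], then descend along a surviving edge of the preceding
    matching. *)
Let linked_down j x y : j < s -> (forall a, a < j -> ~~ blocked a) ->
  x \in C j -> x \notin S -> y \in C 0 -> y \notin S -> linked x y.
Proof.
move=> + + + + y0 yS; elim: j x => [|j IH] x ltjs nb xj xS.
  exact: (linked_clique s_gt0).
have ltjs' := ltnW ltjs.
have [z [t []]] := unblocked_link ltjs' (nb j (leqnn _)).
rewrite modn_small // => zj tj zS tS zt.
apply: connect_trans (linked_clique ltjs xj tj xS tS) _.
apply: (@connect_trans _ _ z); first by rewrite connect_adj_sym.
by apply: IH => // a lta; apply: nb; apply: ltnW.
Qed.

(** Induction on the distance [d] to the index [s]. The index [j %% s] lets the walk end at [j = s],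
    where the clique is [C 0]. *)
Let linked_up d j x y : j + d = s ->
  (forall b, j <= b < s -> ~~ blocked b) ->
  x \in C (j %% s) -> x \notin S -> y \in C 0 -> y \notin S -> linked x y.
Proof.
move=> + + + + y0 yS; elim: d j x => [|d IH] j x.
  rewrite addn0 => -> _; rewrite modnn => x0 xS.
  exact: (linked_clique s_gt0).
rewrite addnS => eqs nb; have ltjs : j < s by lia.
rewrite modn_small // => xj xS.
have [|z [t [zj tj zS tS zt]]] := unblocked_link ltjs (nb j _).
  by rewrite leqnn.
apply: connect_trans (linked_clique ltjs xj zj xS zS) _.
apply: (connect_trans zt); apply: IH tj tS; first by rewrite addSn.
by move=> b /andP[ltb ltbs]; apply: nb; rewrite ltbs ltnW.
Qed.

Lemma eq_clique_of_sub i : i < s -> #|S| = k + 2 -> S \subset C i -> S = C i.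
Proof. by move=> ltis cS sub; apply/eqP; rewrite eqEcard sub cS (cc_card hG ltis) leqnn. Qed.

(* If both ways round the cycle from [C j] to [C 0] are blocked, at [a] and at
   [b], then S lies in two pairs of consecutive cliques, hence in a single
   clique, which is [C j] or [C 0]. *)
Let linked_to_base j x y : j < s ->
  x \in C j -> x \notin S -> y \in C 0 -> y \notin S -> linked x y.
Proof.
move=> ltjs xj xS y0 yS.
have [/existsP[a ba]|nb] := boolP [exists a : 'I_j, blocked a]; last first.
  apply: (linked_down ltjs) => // a lta.
  by move: nb; rewrite negb_exists => /forallP/(_ (Ordinal lta)).
have [/existsP[b /andP[leb bb]]|nb] :=
    boolP [exists b : 'I_s, (j <= b) && blocked b]; last first.
  apply: (@linked_up (s - j) j); rewrite ?modn_small //; first lia.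
  move=> b /andP[leb ltbs]; move: nb; rewrite negb_exists.
  by move/forallP/(_ (Ordinal ltbs)); rewrite /= leb.
have ltaj := ltn_ord a; have ltbs := ltn_ord b.
have ltas : a < s by apply: ltn_trans ltjs.
have [/subsetP subA cS] := blocked_sub ltas ba.
have [/subsetP subB _] := blocked_sub ltbs bb.
(* Each [z] in [S] lies in one clique of either pair. As [a < j <= b], the pairs can share a clique
   only if [b] follows [a], and then [b = j], or if [a] follows [b] around the end of the cycle. *)
have inS z : z \in S ->
    z \in C j /\ (a.+1 = b :> nat) \/ z \in C 0 /\ (a = 0 :> nat) /\ b.+1 = s.
  move=> zS; move: (subA z zS) (subB z zS); rewrite !inE succ_mod //.
  rewrite ifN; last by lia.
  have ltas' : a.+1 < s by lia.
  case/orP=> za /orP[] zb.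
  - by have := clique_index_inj ltas ltbs za zb; lia.
  - have := clique_index_inj ltas (succ_mod_lt b) za zb.
    rewrite succ_mod //; case: eqP => [bs a0|_]; last by lia.
    by right; rewrite -a0.
  - have ab := clique_index_inj ltas' ltbs za zb.
    by left; split=> //; rewrite (_ : j = a.+1) //; lia.
  - have := clique_index_inj ltas' (succ_mod_lt b) za zb.
    by rewrite succ_mod //; case: eqP; lia.
(* The two alternatives exclude each other: together they would give [s = 2]. Thus [S] is [C j],
   which contradicts [x \notin S], or [C 0], which is excluded by [neS]. *)
have [ab|nab] := eqVneq a.+1 (b : nat).
  suff eqS : S = C j by rewrite eqS xj in xS.
  apply: eq_clique_of_sub => //; apply/subsetP=> z /inS[[]//|[_ [a0 bs]]]; lia.
case/eqP: neS; apply: eq_clique_of_sub => //; apply/subsetP=> z /inS[[_ ab]|[]//].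
by case/eqP: nab.
Qed.

(** Since [S] is no larger than [C 0] and differs from it, some [r] in [C 0] survives; every
    remaining vertex, the apex included, is linked to [r]. *)
Lemma small_set_not_cut : ~ is_cut G S.
Proof.
case=> _ /disconnectedP[x [y [xV yV /negP[]]]].
have [r r0 rS] : exists2 r, r \in C 0 & r \notin S.
  apply/subsetPn; apply: contra neS => sub.
  by rewrite eq_sym eqEcard sub (cc_card hG).
have to_r z : z \in verts (remove G S) -> linked z r.
  rewrite verts_remove !inE => /andP[zS /vertsE[eqz|[j ltjs zj]]].
    apply: connect1; rewrite adj_remove zS rS !andbT.
    by have := r0; rewrite -neighbors_apex inE eqz.
  exact: (linked_to_base ltjs).
by apply: connect_trans (to_r x xV) _; rewrite connect_adj_sym to_r.
Qed.

End SmallCut.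
End CliqueCycle.

(** * Assembling the order, the size and the unique minimum cut *)

Theorem mainTheorem4 (T : finType) (k s : nat) (G : graph T)
    (C : nat -> {set T}) (M : nat -> {set {set T}}) (u : T)
    (hk : (2 <= k)%N) (hs : (3 <= s)%N)
    (hG : clique_cycle_with_apex k s G C M u) :
  [/\ graph_order G = ((k + 2) * s + 1)%N,
      ((graph_size G)%:R = ((k%:R + 3%:R) / 2%:R * (graph_order G)%:R
                            + (k%:R - 1) / 2%:R) + 1 :> rat)%R,
      neighbors G u = C 0%N,
      (forall S : {set T}, minimum_cut G S <-> S = neighbors G u)
    & ~ degenerate_cut k G (neighbors G u)].
Proof.
have s_gt0 : 0 < s by apply: leq_trans hs.
have cut0 := apex_clique_cut hs hG.
have card0 : #|C 0| = k + 2 by apply: (cc_card hG).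
have cut_small S : is_cut G S -> #|S| <= k + 2 -> S = C 0.
  move=> cutS leS; apply/eqP; apply: contraT => ne.
  by case: (small_set_not_cut hs hG leS ne).
rewrite (neighbors_apex hs hG); split=> //.
- exact: (clique_cycle_order hG).
(* The binomial coefficient is doubled to avoid division in the naturals, and halved again only
   after the cast to [rat]. *)
- have dbl : 'C(k + 2, 2) * 2 = (k + 2) * (k + 1).
    by rewrite (bin_ffact _ 2) ffactnS ffactn1 addn2 addn1.
  have dbl' : ('C(k + 2, 2)%:R = (k%:R + 2) * (k%:R + 1) / 2 :> rat)%R.
    apply: (GRing.mulIf (x := 2%:R%R)); first by [].
    by rewrite -GRing.natrM dbl GRing.mulfVK // GRing.natrM !GRing.natrD.
  rewrite (clique_cycle_size hs hG) (clique_cycle_order hG).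
  by rewrite !(GRing.natrD, GRing.natrM) dbl'; field.
- move=> S; split=> [[cutS minS]|->].
    by apply: cut_small; rewrite // -card0; apply: minS.
  (* A cut with fewer than [k + 2] vertices would itself be [C 0], which has exactly [k + 2]. *)
  split=> // S' cutS'; rewrite leqNgt card0; apply/negP=> lt.
  by move: (lt); rewrite (cut_small S' cutS' (ltnW lt)) card0 ltnn.
apply: clique_not_degenerate; last by rewrite card0 addn2.
  exact: (clique_sub_verts hG).
exact: (clique_edges_sub_edges hG).
Qed.
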